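(* Let $\Omega_B=(0,l_1)\times\dots\times(0,l_{d-1})$ with $l_i>0$, $\Gamma_B=\Omega_B\times\{0\}$, $H>0$, $\Omega_h=\Omega_B\times(0,h)$ for $0<h\le H$, and $\Omega:=\Omega_H$. Then Korn's inequality holds with a constant independent of $h$: if $K_{\Omega,\Gamma_B}$ denotes a constant in Korn's inequality on $\Omega$, i.e. $\int_\Omega|\nabla v|^2\,dx\le K_{\Omega,\Gamma_B}\int_\Omega|\mathcal E(v)|^2\,dx$ for all $v\in H^1_B(\Omega)^d$, then for every $h\in(0,H]$ $$\int_{\Omega_h}|\nabla u(x)|^2\,dx\le K_{\Omega,\Gamma_B}\,2^{d-1}\int_{\Omega_h}|\mathcal E(u(x))|^2\,dx\qquad\forall\,u\in H^1_B(\Omega_h)^d .$$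
   Context: $d\in\{2,3\}$. $H^1_B(\Omega_h):=\{y\in H^1(\Omega_h): y|_{\Gamma_B}=0\text{ a.e.}\}$ (in the sense of traces). $\mathcal E(u):=\tfrac12(\nabla u+\nabla u^T)$, and $|\cdot|$ is the Frobenius norm of matrices. A finite constant $K_{\Omega,\Gamma_B}$, depending only on $\Omega$ and $\Gamma_B$, exists by the classical Korn inequality. *)

(* Defs.v *)
From HB Require Import structures.
From mathcomp Require Export all_boot all_order all_algebra.
From mathcomp Require Export all_classical all_reals all_analysis.

Set Implicit Arguments.
Unset Strict Implicit.
Unset Printing Implicit Defensive.

Export Order.TTheory GRing.Theory Num.Theory.
Export numFieldNormedType.Exports.

Local Open Scope classical_set_scope.
Local Open Scope ring_scope.

Section rV_measurable.
Variables (R : realType) (n : nat).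

(* The product sigma-algebra (i.e. the Borel sets) on 'rV[R]_n, generated by
   the coordinates, as the library does for n.-tuple R. *)
Let coor : 'I_n -> 'rV[R]_n -> R := fun i x => x 0 i.

Let rV_set0 : g_sigma_preimage coor set0.
Proof. exact: sigma_algebra0. Qed.

Let rV_setC A : g_sigma_preimage coor A -> g_sigma_preimage coor (~` A).
Proof. exact: sigma_algebraC. Qed.

Let rV_bigcup (F : (set 'rV[R]_n)^nat) :
  (forall i, g_sigma_preimage coor (F i)) ->
  g_sigma_preimage coor (\bigcup_i (F i)).
Proof. exact: sigma_algebra_bigcup. Qed.

HB.instance Definition _ := @isMeasurable.Build default_measure_display
  'rV[R]_n (g_sigma_preimage coor) rV_set0 rV_setC rV_bigcup.

End rV_measurable.

Lemma measurable_coord (R : realType) n (i : 'I_n) :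
  measurable_fun [set: 'rV[R]_n] (fun x : 'rV[R]_n => x 0 i).
Proof.
move=> _ Y mY; rewrite setTI; apply: sub_sigma_algebra => /=.
rewrite -bigcup_seq/=; exists i => /=; first by rewrite mem_index_enum.
by exists Y => //; rewrite setTI.
Qed.

Lemma measurable_fun_rVP (R : realType) d (T : measurableType d) n
    (f : T -> 'rV[R]_n) :
  measurable_fun [set: T] f <->
  forall i, measurable_fun [set: T] (fun x => f x 0 i).
Proof.
split=> [mf i|mf].
  exact: (measurableT_comp (@measurable_coord R n i) mf).
pose co i (x : 'rV[R]_n) : R := x 0 i.
suff S : g_sigma_preimage (fun i => co i \o f) `<=` measurable.
  move=> _ A mA; rewrite setTI; apply: S.
  by rewrite g_sigma_preimage_comp; exists A => //; rewrite setTI.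
apply: smallest_sub; first exact: sigma_algebra_measurable.
case: n => [|n] in f mf co *; first by rewrite big_ord0.
rewrite -bigcup_mkord_ord; apply: bigcup_sub => i Ii.
by move=> A [B mB <-]; exact: mf.
Qed.

Section snoc.
Variables (R : realType) (n : nat).

(* snoc x' t = (x', t) and base (x', t) = x'; the last coordinate, of index
   ord_max, is the vertical one. *)
Definition snoc (x : 'rV[R]_n) (t : R) : 'rV[R]_n.+1 :=
  \row_(j < n.+1) (if unlift ord_max j is Some i then x 0 i else t).

Definition base (x : 'rV[R]_n.+1) : 'rV[R]_n := \row_(i < n) x 0 (lift ord_max i).

Lemma base_snoc x t : base (snoc x t) = x.
Proof. by apply/rowP => i; rewrite !mxE liftK. Qed.

Lemma snoc_last x t : snoc x t 0 ord_max = t.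
Proof. by rewrite mxE unlift_none. Qed.

Lemma snoc_base x : snoc (base x) (x 0 ord_max) = x.
Proof. by apply/rowP => j; rewrite !mxE; case: unliftP => [i|] ->; rewrite ?mxE. Qed.

Definition snoc_pair (p : 'rV[R]_n * measurableTypeR R) : 'rV[R]_n.+1 :=
  snoc p.1 p.2.

Lemma measurable_snoc_pair :
  measurable_fun [set: 'rV[R]_n * measurableTypeR R] snoc_pair.
Proof.
apply/measurable_fun_rVP => j; rewrite /snoc_pair.
under eq_fun do rewrite mxE.
case: unliftP => [i _|_]; last exact: measurable_snd.
exact: (measurableT_comp (@measurable_coord R n i) measurable_fst).
Qed.

HB.instance Definition _ :=
  isMeasurableFun.Build _ _ _ _ snoc_pair measurable_snoc_pair.

Lemma measurable_base : measurable_fun [set: 'rV[R]_n.+1] base.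
Proof.
apply/measurable_fun_rVP => i.
under eq_fun do rewrite mxE.
exact: measurable_coord.
Qed.

End snoc.

Section snoc_measure.
Local Open Scope ereal_scope.
Variables (R : realType) (n : nat).
Variable mu : {sigma_finite_measure set 'rV[R]_n -> \bar R}.

Definition snoc_measure : set 'rV[R]_n.+1 -> \bar R :=
  pushforward (mu \x (@lebesgue_measure R)) (@snoc_pair R n).

Let snoc_measure0 : snoc_measure set0 = 0.
Proof. by rewrite /snoc_measure /pushforward preimage_set0 measure0. Qed.

Let snoc_measure_ge0 A : 0 <= snoc_measure A.
Proof. exact: measure_ge0. Qed.

Let snoc_measure_sigma_additive : semi_sigma_additive snoc_measure.
Proof.
move=> F mF tF mUF; rewrite /snoc_measure /pushforward preimage_bigcup.
have mS := @measurable_snoc_pair R n.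
apply: measure_semi_sigma_additive.
- by move=> k; rewrite -[X in measurable X]setTI; exact: mS.
- apply/trivIsetP => /= i j _ _ ij; rewrite -preimage_setI.
  by move/trivIsetP : tF => /(_ _ _ _ _ ij) ->//; rewrite preimage_set0.
- by rewrite -preimage_bigcup -[X in measurable X]setTI; exact: mS.
Qed.

HB.instance Definition _ := isMeasure.Build _ _ _ snoc_measure
  snoc_measure0 snoc_measure_ge0 snoc_measure_sigma_additive.

Let snoc_measure_sigma_finite : sigma_finite setT snoc_measure.
Proof.
have /sigma_finiteP[F [TF ndF Foo]] := sigma_finiteT mu.
have /sigma_finiteP[G [TG ndG Goo]] := sigma_finiteT (@lebesgue_measure R).
exists (fun k => (@base R n @^-1` F k) `&`
    ((fun x : 'rV[R]_n.+1 => x 0%R ord_max) @^-1` G k)).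
  apply/esym/seteqP; split=> // x _.
  have [i _ Fi] : (\bigcup_i F i) (base x) by rewrite -TF.
  have [j _ Gj] : (\bigcup_i G i) (x 0%R ord_max) by rewrite -TG.
  exists (maxn i j) => //; split => /=.
  - by move: Fi; exact/subsetPset/ndF/leq_maxl.
  - by move: Gj; exact/subsetPset/ndG/leq_maxr.
move=> k; have [mF Fk] := Foo k; have [mG Gk] := Goo k; split.
  apply: measurableI; rewrite -[X in measurable X]setTI.
    exact: measurable_base.
  exact: (@measurable_coord R n.+1 ord_max _ _ mG).
rewrite /snoc_measure /pushforward.
rewrite (_ : _ @^-1` _ = F k `*` G k).
  by rewrite product_measure1E// lte_mul_pinfty// ge0_fin_numE.
by apply/seteqP; split=> -[x t]; rewrite /preimage /= /snoc_pair base_snoc snoc_last.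
Qed.

HB.instance Definition _ := Measure_isSigmaFinite.Build _ _ _ snoc_measure
  snoc_measure_sigma_finite.

End snoc_measure.

(* n-dimensional Lebesgue measure, the product of n copies of the
   one-dimensional one. *)
Fixpoint lebesgue_rV (R : realType) (n : nat) :
    {sigma_finite_measure set 'rV[R]_n -> \bar R} :=
  match n with
  | 0 => \d_(0 : 'rV[R]_0)
  | m.+1 => snoc_measure (lebesgue_rV R m)
  end.

Section sobolev.
Variables (R : realType) (d : nat).
Local Notation leb := (lebesgue_rV R d).
Implicit Types (Omega : set 'rV[R]_d) (i : 'I_d).

Definition partial i (f : 'rV[R]_d -> R) : 'rV[R]_d -> R :=
  fun x => 'D_(delta_mx 0 i) f x.

(* All partial derivatives of order at most k exist and are continuous on the
   whole space. *)
Fixpoint Cn (k : nat) (f : 'rV[R]_d -> R) : Prop :=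
  continuous f /\
  match k with
  | 0 => True
  | m.+1 => forall i, (forall x, derivable f x (delta_mx 0 i)) /\
                      Cn m (partial i f)
  end.

Definition smooth (f : 'rV[R]_d -> R) : Prop := forall k, Cn k f.

Definition test_function Omega (f : 'rV[R]_d -> R) : Prop :=
  [/\ smooth f, compact (closure [set x | f x != 0]) &
      closure [set x | f x != 0] `<=` Omega].

(* Functions are total; membership in L^2(Omega), H^1(Omega), etc. only
   concerns their values on Omega. *)
Definition L2 Omega (f : 'rV[R]_d -> R) : Prop :=
  measurable_fun Omega f /\ leb.-integrable Omega (fun x => (f x ^+ 2)%:E).

Definition weak_partial Omega i (f g : 'rV[R]_d -> R) : Prop :=
  forall phi, test_function Omega phi ->
    \int[leb]_(x in Omega) (f x * partial i phi x) =
    - \int[leb]_(x in Omega) (g x * phi x).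

(* f is in H^1(Omega) with weak gradient g, a representative of a class of
   functions modulo equality almost everywhere in Omega. *)
Definition H1_grad Omega (f : 'rV[R]_d -> R) (g : 'rV[R]_d -> 'rV[R]_d) : Prop :=
  L2 Omega f /\
  forall i, L2 Omega (fun x => g x 0 i) /\
            weak_partial Omega i f (fun x => g x 0 i).

Definition H1 Omega (f : 'rV[R]_d -> R) : Prop := exists g, H1_grad Omega f g.

(* G is the Jacobian matrix of u : row i is the weak gradient of u_i. *)
Definition H1_jacobian Omega (u : 'rV[R]_d -> 'rV[R]_d)
    (G : 'rV[R]_d -> 'M[R]_d) : Prop :=
  forall i, H1_grad Omega (fun x => u x 0 i) (fun x => row i (G x)).

(* \int_Omega f^2 as an extended real *)
Definition L2norm2 Omega (f : 'rV[R]_d -> R) : \bar R :=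
  (\int[leb]_(x in Omega) (f x ^+ 2)%:E)%E.

End sobolev.

Definition frobenius (R : realType) (m n : nat) (A : 'M[R]_(m, n)) : R :=
  Num.sqrt (\sum_i \sum_j A i j ^+ 2).

Definition sym_grad (R : realType) (d : nat) (G : 'M[R]_d) : 'M[R]_d :=
  2^-1 *: (G + G^T).

Section thin_domain.
Variables (R : realType) (n : nat) (l : 'rV[R]_n).

Definition OmegaB : set 'rV[R]_n := [set x | forall i, 0 < x 0 i < l 0 i].

Definition Omega (h : R) : set 'rV[R]_n.+1 :=
  [set snoc x t | x in OmegaB & t in `]0, h[].

(* g, as a function on OmegaB, is the trace of y on GammaB = OmegaB x {0}.
   The trace operator is the continuous extension to H^1(Omega h) of the
   restriction of smooth functions on the closure of Omega h, so its graph is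
   the set of limits of (phi, phi restricted to GammaB) in
   H^1(Omega h) x L^2(GammaB). *)
Definition has_trace (h : R) (y : 'rV[R]_n.+1 -> R) (g : 'rV[R]_n -> R) : Prop :=
  L2 OmegaB g /\
  exists (Dy : 'rV[R]_n.+1 -> 'rV[R]_n.+1) (phi : nat -> 'rV[R]_n.+1 -> R),
    [/\ H1_grad (Omega h) y Dy,
        forall k, smooth (phi k),
        (L2norm2 (Omega h) (fun x => phi k x - y x)%R @[k --> \oo] --> 0)%E,
        forall i, (L2norm2 (Omega h) (fun x => partial i (phi k) x - Dy x 0 i)%R
                     @[k --> \oo] --> 0)%E &
        (L2norm2 OmegaB (fun x => phi k (snoc x 0) - g x)%R
           @[k --> \oo] --> 0)%E].

Definition H1B (h : R) (y : 'rV[R]_n.+1 -> R) : Prop :=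
  H1 (Omega h) y /\
  exists g, has_trace h y g /\
            {ae lebesgue_rV R n, forall x, OmegaB x -> g x = 0}.

(* Weak derivatives being unique almost everywhere, G stands for the gradient
   of u, and frobenius (sym_grad (G x)) for |E(u)(x)|. *)
Definition korn (h K : R) : Prop :=
  forall (u : 'rV[R]_n.+1 -> 'rV[R]_n.+1) (G : 'rV[R]_n.+1 -> 'M[R]_n.+1),
    (forall i, H1B h (fun x => u x 0 i)) ->
    H1_jacobian (Omega h) u G ->
    (\int[lebesgue_rV R n.+1]_(x in Omega h) (frobenius (G x) ^+ 2)%:E <=
     K%:E * \int[lebesgue_rV R n.+1]_(x in Omega h)
              (frobenius (sym_grad (G x)) ^+ 2)%:E)%E.

End thin_domain.

(* Main.v *)
From HB Require Import structures.
Require Import Defs.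
From mathcomp Require Import measurable_realfun ring lra.

(* With r = h/H, the domain Omega_h contains the translates a + r Omega_H, for a
   in the plane of Gamma_B, and u(a + r x) is in H^1_B(Omega_H) whenever u is in
   H^1_B(Omega_h). Both sides of Korn's inequality scale alike under x |-> a + r x,
   so it holds with the constant K on each translate. Finitely many of them cover
   Omega_h so that no point is in more than two of the shifted intervals in each
   of the n horizontal directions, hence in more than 2^n translates, and summing
   the inequalities gives the factor 2^n. *)

Set Implicit Arguments.
Unset Strict Implicit.
Unset Printing Implicit Defensive.

Local Open Scope classical_set_scope.
Local Open Scope ring_scope.

(** * Lebesgue measure and homotheties *)

Definition homothety (R : realType) n (b : 'rV[R]_n) (c : R) (x : 'rV[R]_n) :
  'rV[R]_n := b + c *: x.

Section homothety_measure.
Variable R : realType.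
Local Notation leb1 := (@lebesgue_measure R).

Lemma homothetyE n (b : 'rV[R]_n) (c : R) x i : homothety b c x 0 i = b 0 i + c * x 0 i.
Proof. by rewrite !mxE. Qed.

Lemma homothety_snoc n (b : 'rV[R]_n.+1) c x t :
  homothety b c (snoc x t) =
  snoc (homothety (base b) c x) (b 0 ord_max + c * t).
Proof. by apply/rowP => j; rewrite !mxE; case: unliftP => [i|] ->; rewrite ?mxE. Qed.

Lemma measurable_homothety n (b : 'rV[R]_n) c :
  measurable_fun [set: 'rV[R]_n] (homothety b c).
Proof.
apply/measurable_fun_rVP => i; under eq_fun do rewrite homothetyE.
apply: measurable_funD => //; apply: measurable_funM => //.
exact: measurable_coord.
Qed.

Lemma measurable_homothety1 (b c : R) :
  measurable_fun [set: measurableTypeR R]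
    (fun t : measurableTypeR R => b + c * t : measurableTypeR R).
Proof. by apply: measurable_funD => //; apply: measurable_funM. Qed.

(** The pushforward of [leb1] by t |-> b + c t, multiplied by c, gives each half-open interval its
    length; by uniqueness it is Lebesgue measure. *)
Lemma lebesgue_homothety1 (b c : R) (A : set R) : 0 < c -> measurable A ->
  leb1 ((fun t => b + c * t) @^-1` A) = ((c^-1)%:E * leb1 A)%E.
Proof.
move=> c0 mA.
have ci0 : 0 <= c by exact: ltW.
pose T (t : measurableTypeR R) : measurableTypeR R := b + c * t.
pose m : {measure set (measurableTypeR R) -> \bar R} :=
  mscale (NngNum ci0) (pushforward leb1 T).
have E : leb1 A = m (measurable_homothety1 b c) A.
  apply: lebesgue_measure_unique => //= _ [[u v]] _ <-.
  rewrite /m /mscale /= /pushforward /=.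
  have -> : T @^-1` `]u, v] = `](u - b) / c, (v - b) / c]%classic.
    apply/seteqP; split=> t /=; rewrite !in_itv/= /T ltr_pdivrMr// ler_pdivlMr//;
    rewrite ltrBlDl lerBrDl [_ * c]mulrC; by [].
  rewrite !lebesgue_measure_itv/= !lte_fin ltr_pM2r ?invr_gt0// ltrD2r.
  case: ifPn => _; last by rewrite mule0.
  by rewrite -!EFinB -EFinM; congr _%:E; field; rewrite gt_eqF.
by rewrite E /m /mscale /= muleA -EFinM mulVf ?gt_eqF// mul1e.
Qed.

(** Induction on the dimension through vertical sections: each section contributes one factor
    [c^-1], and the base contributes the others. *)
Lemma lebesgue_homothety n (b : 'rV[R]_n) c (A : set 'rV[R]_n) :
  0 < c -> measurable A ->
  lebesgue_rV R n (homothety b c @^-1` A) = ((c^-1 ^+ n)%:E * lebesgue_rV R n A)%E.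
Proof.
move=> c0; elim: n => [|n IH] in b A *.
  move=> _; rewrite expr0 mul1e; congr (lebesgue_rV _ _ _).
  apply/seteqP; split=> x /=; by rewrite (_ : homothety _ _ _ = x)//; apply/rowP => -[].
move=> mA /=; rewrite /snoc_measure /pushforward /product_measure1 /=.
set B := @snoc_pair R n @^-1` A.
have mB : measurable B.
  by rewrite /B -[X in measurable X]setTI; exact: measurable_snoc_pair.
have ci0 : 0 <= c^-1 ^+ n by rewrite exprn_ge0// invr_ge0 ltW.
have mP : measurable_fun setT (leb1 \o xsection B) by exact: measurable_fun_xsection.
transitivity (\int[lebesgue_rV R n]_x
    ((c^-1)%:E * (leb1 \o xsection B) (homothety (base b) c x)))%E.
  apply: eq_integral => x _ /=.
  rewrite -(lebesgue_homothety1 (b 0 ord_max))//; last first.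
    exact: measurable_xsection.
  congr (leb1 _); rewrite /xsection /B; apply/seteqP; split => t /=;
  by rewrite !inE /= /snoc_pair homothety_snoc.
rewrite ge0_integralZl//; last 2 first.
  exact: (measurableT_comp mP (measurable_homothety (base b) c)).
  by rewrite lee_fin invr_ge0 ltW.
rewrite -[X in (_ * X)%E](ge0_integral_pushforward
  (measurable_homothety (base b) c) _ measurableT mP)//.
(* The induction hypothesis, read as an equality of measures: the pushforward of [lebesgue_rV R n]
   by the base homothety is [c^-1 ^+ n] times itself. *)
rewrite (eq_measure_integral (mscale (NngNum ci0) (lebesgue_rV R n))) //=; last 2 first.
- exact: measurable_homothety.
- by move=> _ C mC _; rewrite /mscale/= -(IH (base b)).
by rewrite ge0_integral_mscale//= muleA -EFinM exprS.
Qed.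

Lemma ge0_integral_homothety n (b : 'rV[R]_n) c (D : set 'rV[R]_n) f :
  0 < c -> measurable D -> measurable_fun D f -> (forall x, D x -> 0 <= f x)%E ->
  (\int[lebesgue_rV R n]_(x in homothety b c @^-1` D) f (homothety b c x) =
   (c^-1 ^+ n)%:E * \int[lebesgue_rV R n]_(x in D) f x)%E.
Proof.
move=> c0 mD mf f0.
have ci0 : 0 <= c^-1 ^+ n by rewrite exprn_ge0// invr_ge0 ltW.
rewrite -[LHS](ge0_integral_pushforward (measurable_homothety b c) _ mD mf)//; last first.
  by move=> x; rewrite inE; exact: f0.
rewrite (eq_measure_integral (mscale (NngNum ci0) (lebesgue_rV R n))) //=; last 2 first.
- exact: measurable_homothety.
- by move=> _ C mC _; rewrite /mscale/= -(lebesgue_homothety b).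
by rewrite ge0_integral_mscale.
Qed.

Lemma measurable_preimage_homothety n (b : 'rV[R]_n) c (D : set 'rV[R]_n) :
  measurable D -> measurable (homothety b c @^-1` D).
Proof. by move=> mD; rewrite -[X in measurable X]setTI; exact: measurable_homothety. Qed.

Lemma measurable_fun_homothety n (b : 'rV[R]_n) c (D : set 'rV[R]_n)
    d (T : measurableType d) (f : 'rV[R]_n -> T) :
  measurable D -> measurable_fun D f ->
  measurable_fun (homothety b c @^-1` D) (f \o homothety b c).
Proof.
move=> mD mf; apply: (measurable_comp mD _ mf) => [_ [x Dx <-]//|].
by apply: measurable_funS (measurable_homothety b c).
Qed.

Lemma integral_homothety n (b : 'rV[R]_n) c (D : set 'rV[R]_n) f :
  0 < c -> measurable D -> measurable_fun D f ->
  (\int[lebesgue_rV R n]_(x in homothety b c @^-1` D) f (homothety b c x) =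
   (c^-1 ^+ n)%:E * \int[lebesgue_rV R n]_(x in D) f x)%E.
Proof.
move=> c0 mD mf; have cn0 : 0 < c^-1 ^+ n by rewrite exprn_gt0// invr_gt0.
rewrite integralE [in RHS]integralE.
under eq_integral do rewrite (funepos_comp f (homothety b c)) /=.
under [X in (_ - X)%E]eq_integral do rewrite (funeneg_comp f (homothety b c)) /=.
rewrite ge0_integral_homothety//; last exact: measurable_funepos.
rewrite (ge0_integral_homothety _ (f := f^\-)%E)//; last exact: measurable_funeneg.
set p := integral _ _ _; set q := integral _ _ _.
have p0 : (0 <= p)%E by exact: integral_ge0.
have q0 : (0 <= q)%E by exact: integral_ge0.
(* Integrability is not assumed, so either part may be infinite; a positive finite factor passes
   through the difference in every case. *)
case: p p0 q q0 => [p| |] // _ [q| |] // _.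
- by rewrite muleBr.
- by rewrite /= gt0_muley// gt0_muleNy.
- by rewrite /= gt0_muley.
- by rewrite /= gt0_muley// gt0_muleNy.
Qed.

Lemma Rintegral_homothety n (b : 'rV[R]_n) c (D : set 'rV[R]_n) (f : 'rV[R]_n -> R) :
  0 < c -> measurable D -> measurable_fun D f ->
  (\int[lebesgue_rV R n]_(x in homothety b c @^-1` D) f (homothety b c x) =
   c^-1 ^+ n * \int[lebesgue_rV R n]_(x in D) f x).
Proof.
move=> c0 mD mf; have cn0 : 0 < c^-1 ^+ n by rewrite exprn_gt0// invr_gt0.
rewrite /Rintegral (integral_homothety _ (f := EFin \o f))//; last exact/measurable_EFinP.
(* When the extended integral is infinite, its real value is 0 by convention and both sides
   vanish. *)
case: (integral _ _ _) => [r| |] //=.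
  by rewrite gt0_muley// mulr0.
by rewrite gt0_muleNy// mulr0.
Qed.

End homothety_measure.

(** * Smooth functions and homotheties *)

Section continuous_rV.
Variable R : realType.

(** The sigma-algebra is generated by the coordinates, while open sets come from the norm. The link
    is that U is the countable union of the cubes with rational centre and radius 1/(k+1) that it
    contains. *)
Lemma open_measurable_rV n (U : set 'rV[R]_n) : open U -> measurable U.
Proof.
move=> oU.
pose box (p : 'rV[rat]_n * nat) : set 'rV[R]_n :=
  \bigcap_(i in [set: 'I_n])
    ((fun x : 'rV[R]_n => x 0 i) @^-1` ball (ratr (p.1 0 i) : R) p.2.+1%:R^-1).
pose F p := if `[< box p `<=` U >] then box p else set0.
have mF p : measurable (F p).
  rewrite /F; case: ifP => // _; apply: fin_bigcap_measurable => // i _.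
  rewrite -[X in measurable X]setTI; apply: (@measurable_coord R n i) => //.
  exact: measurable_ball.
rewrite (_ : U = \bigcup_p F p); first exact: countable_bigcupT_measurable.
apply/seteqP; split=> [x Ux|x [p _]]; last first.
  by rewrite /F; case: asboolP => // pU /pU.
have /nbhs_ballP[e /= e0 xeU] : nbhs x U by exact: open_nbhs_nbhs.
(* With this k, two points of a cube of radius 1/(k+1) are less than e apart, so a cube containing x
   stays in the e-ball around x. *)
pose k := Num.truncn (2 * e^-1).
have ke : k.+1%:R^-1 < e / 2.
  by rewrite -[e / 2]invrK ltf_pV2 ?posrE ?invr_gt0 ?divr_gt0// invf_div truncnS_gt.
have /choice[q xq] : forall i, exists q : rat, ball (ratr q : R) k.+1%:R^-1 (x 0 i).
  move=> i; have /rat_in_itvoo[q] : x 0 i - k.+1%:R^-1 < x 0 i + k.+1%:R^-1.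
    by rewrite ltrBlDr -addrA ltrDl addr_gt0// invr_gt0.
  by rewrite in_itv/= => xq; exists q; rewrite /ball/= ltr_distl.
exists (\row_i q i, k) => //.
rewrite /F; case: asboolP => [_ i _|[]]; first by rewrite /= mxE; exact: xq.
move=> y xy; apply: xeU; split=> // a i; rewrite (ord1 a).
apply: (@le_ball _ _ _ (k.+1%:R^-1 + k.+1%:R^-1)).
  by rewrite [leRHS]splitr lerD// ltW.
apply: (ball_triangle (y := ratr (q i) : R)); first exact/ball_sym/xq.
by have := xy i I; rewrite /= mxE.
Qed.

Lemma continuous_measurable_rV n (f : 'rV[R]_n -> R) :
  continuous f -> measurable_fun setT f.
Proof.
move=> /continuousP cf; apply: (measurability _ (RGenOpens.measurableE R)).
move=> _ [_ [a [b ->] <-]]; rewrite setTI; apply: open_measurable_rV.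
exact/cf/interval_open.
Qed.

Lemma continuous_homothety n (b : 'rV[R]_n) c : continuous (homothety b c).
Proof.
move=> x; have h1 : {for x, continuous (fun y : 'rV[R]_n => b)} by exact: cst_continuous.
have h2 : {for x, continuous (fun y : 'rV[R]_n => c *: y)} by exact: scaler_continuous.
exact: (continuousD h1 h2).
Qed.

(** Only a directional derivative is available, so the chain rule is proved on difference quotients:
    the one of the composite at step h is c times the one of f at step c h. *)
Lemma is_derive_homothety n (f : 'rV[R]_n -> R) b c x v :
  c != 0 -> derivable f (homothety b c x) v ->
  is_derive x v (f \o homothety b c) (c * 'D_v f (homothety b c x)).
Proof.
move=> c0 df.
have cvg0 : (fun h : R => c * h) @ 0^' --> 0^'.
  move=> A /nbhs_ballP[e e0 eA]; apply/nbhs_ballP; exists (e / `|c|) => /=.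
    by rewrite divr_gt0// normr_gt0.
  move=> h /= he h0; apply: eA; last by rewrite mulf_neq0.
  move: he; rewrite /ball /= !sub0r !normrN normrM.
  by rewrite ltr_pdivlMr ?normr_gt0// mulrC.
have E : (fun h => h^-1 *: (((f \o homothety b c) \o shift x) (h *: v) -
             (f \o homothety b c) x)) =1
    (fun h => c * ((fun h => h^-1 *: ((f \o shift (homothety b c x)) (h *: v) -
             f (homothety b c x))) \o (fun h => c * h)) h).
  move=> h; rewrite /GRing.scale /= invfM mulrA mulrA divff// mul1r.
  by congr (_ * (f _ - _)); rewrite /homothety scalerDr scalerA addrCA.
have L : (fun h => h^-1 *: (((f \o homothety b c) \o shift x) (h *: v) -
             (f \o homothety b c) x)) @ 0^' --> c * 'D_v f (homothety b c x).
  rewrite (funext E); apply: cvgMl_tmp; apply: cvg_comp; first exact: cvg0.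
  exact: df.
by apply: DeriveDef; [apply/cvg_ex; eexists; exact: L|exact: cvg_lim L].
Qed.

Lemma continuous_comp_homothety n (f : 'rV[R]_n -> R) a b c :
  continuous f -> continuous (fun x => a * f (homothety b c x)).
Proof.
move=> cf x.
have h : {for x, continuous (f \o homothety b c)}.
  exact: (continuous_comp (@continuous_homothety _ b c x) (cf _)).
exact: (cvgMl_tmp h).
Qed.

(** The scalar a closes the induction on k: a partial derivative has the same form, with [a * c] for
    a and [partial i f] for f. *)
Lemma Cn_homothety n (f : 'rV[R]_n -> R) a b c k : c != 0 ->
  Cn k f -> Cn k (fun x => a * f (homothety b c x)).
Proof.
move=> c0; elim: k => [|k IH] in a f *.
  by move=> [cf _]; split => //; exact: continuous_comp_homothety.
move=> [cf Df]; split => [|i]; first exact: continuous_comp_homothety.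
have [dfi Cfi] := Df i.
have D x : is_derive x (delta_mx 0 i) (fun x => a * f (homothety b c x))
    (a * (c * partial i f (homothety b c x))).
  by have ? := is_derive_homothety c0 (dfi (homothety b c x)); exact: is_deriveZ.
split=> [x|]; first by have [] := D x.
rewrite (_ : partial i _ = fun x => a * c * partial i f (homothety b c x)).
  exact: IH.
by apply/funext => x; rewrite -mulrA /partial; have [_ ->] := D x.
Qed.

Lemma smooth_homothety n (f : 'rV[R]_n -> R) a b c : c != 0 ->
  smooth f -> smooth (fun x => a * f (homothety b c x)).
Proof. by move=> c0 sf k; exact: Cn_homothety. Qed.

Lemma partial_homothety n i (f : 'rV[R]_n -> R) a b c x : c != 0 -> smooth f ->
  partial i (fun x => a * f (homothety b c x)) x =
  a * c * partial i f (homothety b c x).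
Proof.
move=> c0 sf; have [_ /(_ i)[df _]] := sf 1%N.
have ? := is_derive_homothety c0 (df (homothety b c x)).
have [_] : is_derive x (delta_mx 0 i) (fun x => a * f (homothety b c x))
    (a * (c * partial i f (homothety b c x))) by exact: is_deriveZ.
by rewrite mulrA.
Qed.

Lemma smooth_measurable n (f : 'rV[R]_n -> R) : smooth f -> measurable_fun setT f.
Proof. by move=> /(_ 0%N)[cf _]; exact: continuous_measurable_rV. Qed.

Lemma smooth_partial_measurable n i (f : 'rV[R]_n -> R) :
  smooth f -> measurable_fun setT (partial i f).
Proof.
by move=> /(_ 1%N)[_ /(_ i)[_ [cf _]]]; exact: continuous_measurable_rV.
Qed.

Lemma homothetyK n (b : 'rV[R]_n) c : c != 0 ->
  cancel (homothety b c) (homothety (- (c^-1 *: b)) c^-1).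
Proof.
by move=> c0 x; rewrite /homothety scalerDr scalerA mulVf// scale1r addKr.
Qed.

Lemma homothetyVK n (b : 'rV[R]_n) c : c != 0 ->
  cancel (homothety (- (c^-1 *: b)) c^-1) (homothety b c).
Proof.
move=> c0 x; rewrite /homothety scalerDr scalerN !scalerA mulfV// !scale1r.
by rewrite addrA subrr add0r.
Qed.

(** The new support is a closed subset of the image under T of the support of phi, which is compact
    and lies in D. *)
Lemma test_function_homothety n (D : set 'rV[R]_n) phi a b c : c != 0 ->
  test_function (homothety b c @^-1` D) phi ->
  test_function D (fun x => a * phi (homothety (- (c^-1 *: b)) c^-1 x)).
Proof.
move=> c0 [sphi Kphi phiD].
set T := homothety b c; set S := homothety _ _.
have SK : cancel S T by exact: homothetyVK.
have sub : closure [set x | a * phi (S x) != 0] `<=`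
    T @` closure [set x | phi x != 0].
  move=> y Cy; exists (S y); last exact: SK.
  move=> B nB; have : nbhs y (S @^-1` B) by exact: continuous_homothety.
  move=> /Cy[z [/= pz Bz]]; exists (S z); split => //=.
  by apply: contraNneq pz => ->; rewrite mulr0.
split; first by apply: smooth_homothety; rewrite ?invr_eq0.
- apply: subclosed_compact sub; first exact: closed_closure.
  apply: continuous_compact => //; apply: continuous_subspaceT.
  exact: continuous_homothety.
- by move=> y /sub[x /phiD + <-].
Qed.

(** The complement of the support is open, so phi vanishes on a whole neighbourhood of x. This lets
    integrals against a test function pass between two domains. *)
Lemma test_function_eq0 n (D : set 'rV[R]_n) phi x :
  test_function D phi -> ~ D x -> phi x = 0 /\ forall i, partial i phi x = 0.
Proof.
move=> [_ _ phiD] Dx.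
have : nbhs x (~` closure [set x | phi x != 0]).
  apply: open_nbhs_nbhs; split; first exact/closed_openC/closed_closure.
  by move=> /phiD.
move=> nx; have phi0 : \forall y \near x, phi y = cst 0 y.
  apply: filterS nx => y /= Cy; apply: contrapT => /eqP phiy.
  exact/Cy/subset_closure.
split=> [|i]; first exact: (nbhs_singleton phi0).
by rewrite /partial (near_eq_derive _ phi0) derive_cst.
Qed.

End continuous_rV.

(** * Sobolev functions and homotheties *)

Section pullback.
Variables (R : realType) (n : nat) (b : 'rV[R]_n) (c : R) (D E : set 'rV[R]_n).
Hypotheses (c0 : 0 < c) (mD : measurable D) (mE : measurable E).
Hypothesis DE : D `<=` homothety b c @^-1` E.
Local Notation T := (homothety b c).
Local Notation leb := (lebesgue_rV R n).

Let c_neq0 : c != 0. Proof. by rewrite gt_eqF. Qed.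

Lemma measurable_fun_pullback d' (U : measurableType d') (f : 'rV[R]_n -> U) :
  measurable_fun E f -> measurable_fun D (f \o T).
Proof.
move=> mf; apply: measurable_funS DE _; first exact: measurable_preimage_homothety.
exact: measurable_fun_homothety.
Qed.

Lemma ge0_integral_pullback_le f : measurable_fun E f ->
    (forall x, E x -> 0 <= f x)%E ->
  (\int[leb]_(x in D) f (T x) <= (c^-1 ^+ n)%:E * \int[leb]_(x in E) f x)%E.
Proof.
move=> mf f0; rewrite -(ge0_integral_homothety b)//.
apply: ge0_subset_integral => //.
- exact: measurable_preimage_homothety.
- exact: measurable_fun_homothety.
- by move=> x; exact: f0.
Qed.

(** The scalar a serves both uses: 1 for the values of a function, and the ratio of the homothety
    for its derivatives. *)
Lemma L2norm2_pullback_le (a : R) (u : 'rV[R]_n -> R) : measurable_fun E u ->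
  (L2norm2 D (fun x => a * u (T x))%R <= (a ^+ 2 * c^-1 ^+ n)%:E * L2norm2 E u)%E.
Proof.
move=> mu; rewrite /L2norm2 EFinM -muleA muleC.
have mu2 : measurable_fun E (fun x => (u x ^+ 2)%:E).
  exact/measurable_EFinP/measurable_funX.
under eq_integral do rewrite exprMn EFinM.
rewrite ge0_integralZl//; last 3 first.
- exact: measurable_fun_pullback mu2.
- by move=> x _; rewrite lee_fin sqr_ge0.
- by rewrite lee_fin sqr_ge0.
rewrite [leRHS]muleC; apply: lee_pmul => //; first by rewrite lee_fin sqr_ge0.
  by apply: integral_ge0 => x _; rewrite lee_fin sqr_ge0.
by apply: (ge0_integral_pullback_le mu2) => x _; rewrite lee_fin sqr_ge0.
Qed.

Lemma L2norm2_pullback_cvg0 (a : R) (u : nat -> 'rV[R]_n -> R) :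
  (forall k, measurable_fun E (u k)) ->
  (L2norm2 E (u k) @[k --> \oo] --> 0)%E ->
  (L2norm2 D (fun x => a * u k (T x))%R @[k --> \oo] --> 0)%E.
Proof.
move=> mu u0.
apply: (squeeze_cvge (f := cst 0%E)
  (h := fun k => ((a ^+ 2 * c^-1 ^+ n)%:E * L2norm2 E (u k))%E)).
- apply: nearW => k; rewrite L2norm2_pullback_le// andbT.
  by apply: integral_ge0 => x _; rewrite lee_fin sqr_ge0.
- exact: cvg_cst.
- by rewrite -(mule0 (a ^+ 2 * c^-1 ^+ n)%:E); exact: cvgeZl.
Qed.

Lemma L2_pullback a f : L2 E f -> L2 D (fun x => a * f (T x)).
Proof.
move=> [mf /integrableP[_ foo]].
have mTf : measurable_fun D (fun x => a * f (T x)).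
  by apply: measurable_funM => //; exact: measurable_fun_pullback mf.
split => //; apply/integrableP; split; first exact/measurable_EFinP/measurable_funX.
have abs (g : 'rV[R]_n -> R) A : (\int[leb]_(x in A) `|(g x ^+ 2)%:E| = L2norm2 A g)%E.
  by apply: eq_integral => x _; rewrite gee0_abs// lee_fin sqr_ge0.
rewrite abs; move: foo; rewrite abs => foo.
apply: le_lt_trans (L2norm2_pullback_le a mf) _; rewrite lte_mul_pinfty//.
by rewrite lee_fin mulr_ge0 ?sqr_ge0// exprn_ge0// invr_ge0 ltW.
Qed.

(** A test function on D is carried to one supported in T(D), hence admissible on E. Changing
    variables on both sides of the weak identity on E produces the same Jacobian factor. *)
Lemma weak_partial_pullback i f g :
  measurable_fun E f -> measurable_fun E g -> weak_partial E i f g ->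
  weak_partial D i (f \o T) (fun x => c * g (T x)).
Proof.
move=> mf mg fg phi tphi.
have [sphi _ _] := tphi.
set S := homothety (- (c^-1 *: b)) c^-1.
(* The factor c makes the gradient of psi at T x that of phi at x. *)
pose psi x := c * phi (S x).
have TK : cancel T S by exact: homothetyK.
have ST : T @^-1` (S @^-1` D) = D.
  by apply/seteqP; split=> x; rewrite /preimage /= TK.
have tpsi : test_function (S @^-1` D) psi.
  by apply: test_function_homothety => //; rewrite ST.
have spsi : smooth psi by case: tpsi.
have mSD : measurable (S @^-1` D) by exact: measurable_preimage_homothety.
have SDE : S @^-1` D `<=` E.
  by move=> y /DE; rewrite /preimage /= homothetyVK.
have restr h k : (forall y, ~ (S @^-1` D) y -> k y = 0) ->
    \int[leb]_(y in E) (h y * k y) = \int[leb]_(y in S @^-1` D) (h y * k y).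
  move=> k0; rewrite Rintegral_mkcond [RHS]Rintegral_mkcond.
  apply: eq_Rintegral => y _; rewrite !patchE.
  case: ifPn => [_|yE]; case: ifPn => [yS|yS] //.
    by rewrite k0 ?mulr0//; move: yS; rewrite notin_setE.
  by move: yE; rewrite notin_setE; case; apply: SDE; rewrite inE in yS.
have mSf : measurable_fun (S @^-1` D) f by exact: measurable_funS SDE mf.
have mSg : measurable_fun (S @^-1` D) g by exact: measurable_funS SDE mg.
have cov h : measurable_fun (S @^-1` D) h ->
    \int[leb]_(x in D) h (T x) = c^-1 ^+ n * \int[leb]_(x in S @^-1` D) h x.
  by move=> mh; rewrite -(Rintegral_homothety b)// ST.
have := fg psi; rewrite (restr f); last first.
  by move=> y yD; have [_ ->] := test_function_eq0 tpsi yD.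
rewrite (restr g); last by move=> y yD; have [] := test_function_eq0 tpsi yD.
move=> fgpsi.
transitivity (\int[leb]_(x in D) (f (T x) * partial i psi (T x))).
  apply: eq_Rintegral => x _ /=; rewrite partial_homothety ?invr_eq0//.
  by rewrite divff// mul1r homothetyK.
rewrite (cov (fun y => f y * partial i psi y)); last first.
  apply: measurable_funM => //; apply: measurable_funTS.
  exact: smooth_partial_measurable.
rewrite fgpsi; last by case: tpsi => ? ? ?; split => //; exact: subset_trans SDE.
rewrite mulrN -(cov (fun y => g y * psi y)); last first.
  by apply: measurable_funM => //; apply: measurable_funTS; exact: smooth_measurable.
congr (- _); apply: eq_Rintegral => x _ /=.
by rewrite /psi TK mulrA (mulrC c).
Qed.

Lemma H1_grad_pullback f g : H1_grad E f g ->
  H1_grad D (f \o T) (fun x => c *: g (T x)).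
Proof.
move=> [Lf fg]; split.
  by have := L2_pullback 1 Lf; under eq_fun do rewrite mul1r.
move=> i; have [Lg wfg] := fg i; split.
  by under eq_fun do rewrite mxE; exact: (L2_pullback c Lg).
under [X in weak_partial _ _ _ X]eq_fun do rewrite mxE.
by apply: (weak_partial_pullback (g := fun x => g x 0 i)) => //; [case: Lf|case: Lg].
Qed.

End pullback.

(** * Korn's inequality on a translate of r Omega_H *)

Section frobenius.
Variables (R : realType).

Lemma frobenius2 m n (A : 'M[R]_(m, n)) :
  frobenius A ^+ 2 = \sum_i \sum_j A i j ^+ 2.
Proof. by rewrite sqr_sqrtr//; do 2 apply: sumr_ge0 => ? _; exact: sqr_ge0. Qed.

Lemma frobenius2Z m n c (A : 'M[R]_(m, n)) :
  frobenius (c *: A) ^+ 2 = c ^+ 2 * frobenius A ^+ 2.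
Proof.
rewrite !frobenius2 mulr_sumr; apply: eq_bigr => i _; rewrite mulr_sumr.
by apply: eq_bigr => j _; rewrite mxE exprMn.
Qed.

Lemma sym_gradZ n c (A : 'M[R]_n) : sym_grad (c *: A) = c *: sym_grad A.
Proof. by apply/matrixP => i j; rewrite !mxE; ring. Qed.

Lemma measurable_frobenius2 d (T : measurableType d) (E : set T) m n
    (A : T -> 'M[R]_(m, n)) :
  (forall i j, measurable_fun E (fun x => A x i j)) ->
  measurable_fun E (fun x => frobenius (A x) ^+ 2).
Proof.
move=> mA; under eq_fun do rewrite frobenius2.
by do 2 (apply: measurable_sum => ?); exact: measurable_funX.
Qed.

End frobenius.

Section thin_domain.
Variables (R : realType) (n : nat) (l : 'rV[R]_n).
Implicit Types (a : 'rV[R]_n) (h H r : R).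

Lemma OmegaE h x : Omega l h x <->
  OmegaB l (base x) /\ 0 < x 0 ord_max < h.
Proof.
split=> [[y By [t + <-]]|[Bx xh]]; last first.
  by exists (base x) => //; exists (x 0 ord_max); rewrite ?snoc_base//= in_itv.
by rewrite /= in_itv /= base_snoc snoc_last.
Qed.

Lemma measurable_OmegaB : measurable (OmegaB l).
Proof.
rewrite (_ : OmegaB l = \bigcap_(i in [set: 'I_n])
    ((fun x : 'rV[R]_n => x 0 i) @^-1` `]0, l 0 i[)); last first.
  apply/seteqP; split=> x /=.
    by move=> Bx i _; rewrite /= in_itv; exact: Bx.
  by move=> Bx i; have := Bx i I; rewrite /= in_itv.
apply: fin_bigcap_measurable => // i _; rewrite -[X in measurable X]setTI.
by apply: (@measurable_coord R n i).
Qed.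

Lemma measurable_Omega h : measurable (Omega l h).
Proof.
rewrite (_ : Omega l h = (@base R n @^-1` OmegaB l) `&`
    ((fun x : 'rV[R]_n.+1 => x 0 ord_max) @^-1` `]0, h[)); last first.
  by apply/seteqP; split=> x; rewrite /= in_itv /= => /OmegaE.
apply: measurableI; rewrite -[X in measurable X]setTI.
  by apply: measurable_base => //; exact: measurable_OmegaB.
by apply: (@measurable_coord R n.+1 ord_max).
Qed.

Section pullback.
Variables (H r : R) (a : 'rV[R]_n).
Hypotheses (r0 : 0 < r) (ar : forall i, 0 <= a 0 i /\ a 0 i + r * l 0 i <= l 0 i).
Local Notation T := (homothety (snoc a 0) r).

Lemma OmegaB_sub_preimage : OmegaB l `<=` homothety a r @^-1` OmegaB l.
Proof.
move=> x Bx i; have /andP[x0 xl] := Bx i; have [a0 arl] := ar i.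
rewrite homothetyE; apply/andP; split; first by rewrite ltr_wpDl// mulr_gt0.
by rewrite (lt_le_trans _ arl)// ltrD2l ltr_pM2l.
Qed.

Lemma Omega_sub_preimage : Omega l H `<=` T @^-1` Omega l (r * H).
Proof.
move=> x /OmegaE[Bx /andP[x0 xH]]; apply/OmegaE.
rewrite -(snoc_base x) homothety_snoc !base_snoc !snoc_last add0r.
by split; [exact: OmegaB_sub_preimage|rewrite mulr_gt0//= ltr_pM2l].
Qed.

(** The smooth approximations are composed with T. Since [snoc a 0] has vertical coordinate 0, T
    maps the plane of Gamma_B to itself, acting there as [homothety a r], so traces are composed
    with that map. *)
Lemma has_trace_pullback y g : has_trace l (r * H) y g ->
  has_trace l H (y \o T) (g \o homothety a r).
Proof.
move=> [[mg ig] [Dy [phi [yDy sphi phiy phiDy phig]]]].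
have rn0 : r != 0 by rewrite gt_eqF.
have mOH := measurable_Omega H; have mO := measurable_Omega (r * H).
have mB := measurable_OmegaB.
have [[my _] yi] := yDy.
split.
  have := L2_pullback r0 mB mB OmegaB_sub_preimage 1 (conj mg ig).
  by under eq_fun do rewrite mul1r.
exists (fun x => r *: Dy (T x)), (fun k x => 1 * phi k (T x)); split.
- exact: (H1_grad_pullback r0 mOH mO Omega_sub_preimage yDy).
- by move=> k; exact: smooth_homothety.
- under eq_fun do under eq_fun do rewrite /= -[y _]mul1r -mulrBr.
  apply: (L2norm2_pullback_cvg0 r0 mOH mO Omega_sub_preimage 1 _ phiy) => k.
  by apply: measurable_funB => //; apply: measurable_funTS; exact: smooth_measurable.
- move=> i.
  under eq_fun do under eq_fun do rewrite partial_homothety// mul1r mxE -mulrBr.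
  apply: (L2norm2_pullback_cvg0 r0 mOH mO Omega_sub_preimage r _ (phiDy i)) => k.
  apply: measurable_funB; last by have [[]] := yi i.
  by apply: measurable_funTS; exact: smooth_partial_measurable.
- under eq_fun do under eq_fun do
    rewrite homothety_snoc base_snoc snoc_last mulr0 addr0 /= -[g _]mul1r -mulrBr.
  apply: (L2norm2_pullback_cvg0 r0 mB mB OmegaB_sub_preimage 1 _ phig) => k.
  apply: measurable_funB => //; apply: measurable_funTS.
  apply: measurableT_comp; first exact: smooth_measurable.
  apply/measurable_fun_rVP => j; under eq_fun do rewrite mxE.
  by case: unliftP => [i _|_]; [exact: measurable_coord|exact: measurable_cst].
Qed.

Lemma H1B_pullback y : H1B l (r * H) y -> H1B l H (y \o T).
Proof.
move=> [[Dy yDy] [g [yg [B [mB B0 gB]]]]]; split.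
  exists (fun x => r *: Dy (T x)); apply: H1_grad_pullback yDy => //.
  - exact: measurable_Omega.
  - exact: measurable_Omega.
  - exact: Omega_sub_preimage.
exists (g \o homothety a r); split; first exact: has_trace_pullback.
exists (homothety a r @^-1` B); split.
- exact: measurable_preimage_homothety.
- by rewrite lebesgue_homothety// B0 mule0.
- move=> x /= gx; apply: gB => /= gTx; apply: gx => Bx; apply: gTx.
  exact: OmegaB_sub_preimage.
Qed.

(** This is the translate T(Omega_H), written as a preimage under the inverse of T so that
    measurability is immediate. *)
Definition box := homothety (- (r^-1 *: snoc a 0)) r^-1 @^-1` Omega l H.

Lemma boxE y : box y <->
  (forall i, a 0 i < y 0 (lift ord_max i) < a 0 i + r * l 0 i) /\
  0 < y 0 ord_max < r * H.
Proof.
rewrite /box /preimage /=; set S := homothety _ _.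
have yE : y = T (S y) by rewrite homothetyVK// gt_eqF.
have yi i : y 0 (lift ord_max i) = a 0 i + r * S y 0 (lift ord_max i).
  by rewrite {1}yE homothetyE mxE liftK.
have yn : y 0 ord_max = r * S y 0 ord_max.
  by rewrite {1}yE homothetyE mxE unlift_none add0r.
have rE i : (0 < S y 0 (lift ord_max i) < l 0 i) =
    (a 0 i < y 0 (lift ord_max i) < a 0 i + r * l 0 i).
  by rewrite yi ltrDl ltrD2l pmulr_rgt0// ltr_pM2l.
have -> : (0 < y 0 ord_max < r * H) = (0 < S y 0 ord_max < H).
  by rewrite yn pmulr_rgt0// ltr_pM2l.
split.
  by move=> /OmegaE[B ->]; split => // i; rewrite -rE; have := B i; rewrite mxE.
by move=> [B ?]; apply/OmegaE; split=> // i; rewrite mxE rE.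
Qed.

Lemma measurable_box : measurable box.
Proof. apply: measurable_preimage_homothety; exact: measurable_Omega. Qed.

Lemma box_sub : box `<=` Omega l (r * H).
Proof.
by move=> y /Omega_sub_preimage; rewrite /preimage /= homothetyVK// gt_eqF.
Qed.

(** The factor [r ^+ 2] is that of the squared gradient of u composed with T. *)
Lemma ge0_integral_box (F : 'rV[R]_n.+1 -> R) :
  measurable_fun (Omega l (r * H)) F -> (forall x, 0 <= F x) ->
  (\int[lebesgue_rV R n.+1]_(x in Omega l H) (r ^+ 2 * F (T x))%:E =
   (r ^+ 2 * r^-1 ^+ n.+1)%:E *
     \int[lebesgue_rV R n.+1]_(x in box) (F x)%:E)%E.
Proof.
move=> mF F0.
have mF' : measurable_fun (Omega l (r * H)) (fun x => (F x)%:E).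
  exact/measurable_EFinP.
under eq_integral do rewrite EFinM.
rewrite ge0_integralZl//; last 4 first.
- exact: measurable_Omega.
- apply: measurable_fun_pullback mF' => //.
  + exact: measurable_Omega.
  + exact: Omega_sub_preimage.
- by move=> x _; rewrite lee_fin.
- by rewrite lee_fin sqr_ge0.
rewrite (EFinM (r ^+ 2)) -muleA; congr (_ * _)%E.
rewrite -(ge0_integral_homothety (snoc a 0))//; last 3 first.
- exact: measurable_box.
- by apply: measurable_funS box_sub mF'; exact: measurable_Omega.
- by move=> x _; rewrite lee_fin.
congr integral; apply/seteqP; split=> x;
by rewrite /box /preimage /= homothetyK// gt_eqF.
Qed.

Lemma korn_box K (u : 'rV[R]_n.+1 -> 'rV[R]_n.+1) G : korn l H K ->
  (forall i, H1B l (r * H) (fun x => u x 0 i)) ->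
  H1_jacobian (Omega l (r * H)) u G ->
  (\int[lebesgue_rV R n.+1]_(x in box) (frobenius (G x) ^+ 2)%:E <=
   K%:E * \int[lebesgue_rV R n.+1]_(x in box)
            (frobenius (sym_grad (G x)) ^+ 2)%:E)%E.
Proof.
move=> hK uB uG.
have mG i j : measurable_fun (Omega l (r * H)) (fun x => G x i j).
  have [_ /(_ j)[[+ _] _]] := uG i.
  by under eq_fun do rewrite mxE.
have := hK (u \o T) (fun x => r *: G (T x)).
under eq_integral do rewrite frobenius2Z.
under [X in (_ -> _ -> (_ <= _ * X)%E) -> _]eq_integral do rewrite sym_gradZ frobenius2Z.
rewrite (ge0_integral_box (F := fun x => frobenius (G x) ^+ 2)); last 2 first.
- exact: measurable_frobenius2.
- by move=> x; exact: sqr_ge0.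
rewrite (ge0_integral_box (F := fun x => frobenius (sym_grad (G x)) ^+ 2)); last 2 first.
- apply: measurable_frobenius2 => i j; under eq_fun do rewrite !mxE.
  by apply: measurable_funM => //; exact: measurable_funD.
- by move=> x; exact: sqr_ge0.
(* Both sides carry the same positive factor [r ^+ 2 * r^-1 ^+ n.+1], which cancels and leaves the
   constant K unchanged. *)
rewrite muleCA lee_pmul2l//; last first.
  by rewrite lte_fin mulr_gt0// exprn_gt0// invr_gt0.
apply=> i; first exact: (H1B_pullback (uB i)).
have -> : (fun x => row i (r *: G (T x))) = (fun x => r *: row i (G (T x))).
  by apply/funext => x; apply/rowP => j; rewrite !mxE.
apply: (H1_grad_pullback (g := fun x => row i (G x)) _ _ _ _ (uG i)) => //.
- exact: measurable_Omega.
- exact: measurable_Omega.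
- exact: Omega_sub_preimage.
Qed.

End pullback.

End thin_domain.

(** * Covering of Omega_h *)

Section covering.
Variables (R : realType).

(* The N+1 open intervals ]j s, j s + r[, with N = floor(1/r) and s = (1-r)/N,
   have union ]0, 1[ because s < r, and no point is in three of them because
   r <= 2 s when N > 1. As they overlap, no null set has to be removed. *)
Definition num_shifts (r : R) : nat := Num.truncn r^-1.

Definition shift_step (r : R) : R := (1 - r) / (num_shifts r)%:R.

Definition covers (r t : R) (j : nat) :=
  j%:R * shift_step r < t < j%:R * shift_step r + r.

Section covers.
Variables (r : R).
Hypotheses (r0 : 0 < r) (r1 : r <= 1).
Local Notation N := (num_shifts r).
Local Notation s := (shift_step r).

Let N_gt0 : (0 < N)%N.
Proof. by rewrite truncn_gt0 invf_ge1. Qed.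

Let Nr : N%:R * r <= 1.
Proof. by rewrite -ler_pdivlMr// mul1r truncn_le// invr_ge0 ltW. Qed.

Let NSr : 1 < N.+1%:R * r.
Proof. by rewrite -ltr_pdivrMr// mul1r truncnS_gt. Qed.

Let N0 : 0 < N%:R :> R. Proof. by rewrite ltr0n. Qed.

Lemma num_shiftsM : N%:R * s = 1 - r.
Proof. by rewrite mulrC divfK// gt_eqF. Qed.

Lemma shift_step_ge0 : 0 <= s.
Proof. by rewrite divr_ge0// subr_ge0. Qed.

(** Amounts to 1 < (N+1) r, the upper half of N = floor(1/r); consecutive intervals therefore
    overlap. *)
Let s_lt : s < r.
Proof.
by rewrite ltr_pdivrMr// ltrBlDr; move: NSr; rewrite -natr1 mulrDl mul1r mulrC.
Qed.

(** Amounts to N r + 2 r <= 2, where both terms are at most 1; intervals j and j+2 are therefore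
    disjoint. *)
Let s_ge : (1 < N)%N -> r <= 2 * s.
Proof.
move=> N1; rewrite mulrA ler_pdivlMr//.
have N2 : 2 <= N%:R :> R by rewrite ler_nat.
have : 2 * r <= 1 by apply: le_trans Nr; rewrite ler_pM2r.
by move: Nr; lra.
Qed.

(** The last interval starting before t contains t: either the next one starts at or after t, and s
    < r, or it is the interval of index N, which ends at 1. *)
Lemma card_covers_gt0 t : 0 < t < 1 -> (0 < #|[pred j : 'I_N.+1 | covers r t j]|)%N.
Proof.
move=> /andP[t0 t1]; apply/card_gt0P.
have [j /= jt jmax] : exists2 j : 'I_N.+1, j%:R * s < t &
    forall k : 'I_N.+1, k%:R * s < t -> (k <= j)%N.
  have P0 : (ord0 : 'I_N.+1)%:R * s < t by rewrite mul0r.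
  by case: (@arg_maxnP _ ord0 (fun k : 'I_N.+1 => k%:R * s < t) val P0) => j; exists j.
exists j; rewrite inE /covers jt /=; have [jN|jN] := ltnP j N.
  have jS : (j.+1 < N.+1)%N by [].
  have [tj|/(jmax (Ordinal jS))] := leP t (j.+1%:R * s); last by rewrite /= ltnn.
  by apply: (le_lt_trans tj); rewrite -natr1 mulrDl mul1r ltrD2l.
have -> : (j : nat) = N by apply/eqP; rewrite eqn_leq jN -ltnS ltn_ord.
by rewrite num_shiftsM subrK.
Qed.

Lemma card_covers_le2 t : (#|[pred j : 'I_N.+1 | covers r t j]| <= 2)%N.
Proof.
have [N1|N1] := leqP N 1.
  by apply: leq_trans (max_card _) _; rewrite card_ord.
set A := [pred _ | _]; case: (pickP A) => [j0 j0A|/eq_card0 ->//].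
have [j /= jA jmin] : exists2 j : 'I_N.+1, j \in A & forall k, k \in A -> (j <= k)%N.
  by case: (@arg_minnP _ j0 (fun k => k \in A) val j0A) => j; exists j.
(* With j the least index in A, only j and j+1 can occur. If j = N, [inord j.+1] falls back on index
   0, which is harmless for an upper bound. *)
suff /subset_leq_card/leq_trans : A \subset pred2 j (inord j.+1).
  by apply; rewrite card2; case: eqP.
apply/fintype.subsetP => k kA; rewrite !inE.
have := jmin _ kA; rewrite leq_eqVlt => /orP[/eqP jk|].
  by rewrite (val_inj jk) eqxx.
rewrite leq_eqVlt => /orP[/eqP jk|jk].
  by apply/orP; right; apply/eqP/val_inj; rewrite /= inordK ?jk.
move: jA kA; rewrite !inE => /andP[_ tj] /andP[kt _].
have : (j.+2)%:R * s <= k%:R * s by rewrite ler_wpM2r ?shift_step_ge0// ler_nat.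
rewrite -!natr1 !mulrDl mul1r; move: (s_ge N1); lra.
Qed.

End covers.

(** Integrates a pointwise bound: the sum of the restrictions of F to the [B i] is F times the
    number of sets containing the point, which lies between 1 and M on E. *)
Lemma ge0_integral_covering d (T : measurableType d) (mu : {measure set T -> \bar R})
    (I : finType) (E : set T) (B : I -> set T) (M : nat) (F : T -> R) :
  measurable E -> (forall i, measurable (B i)) -> (forall i, B i `<=` E) ->
  (forall x, E x -> (0 < \sum_i (x \in B i) <= M)%N) ->
  measurable_fun E F -> (forall x, 0 <= F x) ->
  (\int[mu]_(x in E) (F x)%:E <= \sum_i \int[mu]_(x in B i) (F x)%:E /\
   \sum_i \int[mu]_(x in B i) (F x)%:E <=
     M%:R%:E * \int[mu]_(x in E) (F x)%:E)%E.
Proof.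
move=> mE mB BE cov mF F0.
have mF' : measurable_fun E (EFin \o F) by exact/measurable_EFinP.
have mr i : measurable_fun E ((EFin \o F) \_ (B i)).
  apply/(measurable_restrict _ (mB i) mE).
  by apply: measurable_funS mF' => //; exact: subIsetl.
have r0 i x : (0 <= ((EFin \o F) \_ (B i)) x)%E.
  by rewrite patchE; case: ifP => // _; rewrite lee_fin.
have sumE : (\sum_i \int[mu]_(x in B i) (F x)%:E =
    \int[mu]_(x in E) \sum_i ((EFin \o F) \_ (B i)) x)%E.
  rewrite ge0_integral_sum//; apply: eq_bigr => i _.
  by rewrite -integral_mkcondr (setIidr (BE i)).
have sumF x : (\sum_i ((EFin \o F) \_ (B i)) x =
    (((\sum_i (x \in B i))%N)%:R * F x)%:E)%E.
  rewrite natr_sum mulr_suml -sumEFin; apply: eq_bigr => i _.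
  by rewrite patchE; case: ifP => _; rewrite /= ?mul1r ?mul0r.
have ms : measurable_fun E (fun x => \sum_i ((EFin \o F) \_ (B i)) x)%E.
  by apply: emeasurable_sum => i.
rewrite sumE; split.
  apply: ge0_le_integral => //.
  - by move=> x _; rewrite lee_fin.
  - move=> x /cov /andP[c0 _]; rewrite sumF lee_fin ler_peMl//.
    by rewrite (ler_nat _ 1%N).
rewrite -ge0_integralZl//; last by move=> x _; rewrite lee_fin.
apply: ge0_le_integral => //.
- by move=> x _; apply: sume_ge0.
- exact: measurable_funeM.
- by move=> x /cov /andP[_ cM]; rewrite sumF -EFinM lee_fin ler_wpM2r// ler_nat.
Qed.

(** * Summation of Korn's inequality over the translates *)

Section boxes.
Variables (n : nat) (l : 'rV[R]_n) (H r : R).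
Hypotheses (l0 : forall i, 0 < l 0 i) (r0 : 0 < r) (r1 : r <= 1).

(** f chooses one interval of the covering of ]0, 1[ in each horizontal direction, rescaled to ]0,
    l_i[. *)
Definition shift_row (f : {ffun 'I_n -> 'I_(num_shifts r).+1}) : 'rV[R]_n :=
  \row_i ((f i)%:R * shift_step r * l 0 i).

Lemma shift_row_bound f i :
  0 <= shift_row f 0 i /\ shift_row f 0 i + r * l 0 i <= l 0 i.
Proof.
rewrite mxE; split.
  by apply: mulr_ge0 (ltW (l0 i)); apply: mulr_ge0 => //; exact: shift_step_ge0.
rewrite -mulrDl ler_piMl ?(ltW (l0 i))//.
have E : (num_shifts r)%:R * shift_step r + r = 1 by rewrite num_shiftsM ?subrK.
rewrite -[leRHS]E lerD2r; apply: ler_wpM2r; first exact: shift_step_ge0.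
by rewrite ler_nat -ltnS.
Qed.

Lemma sum_box y : Omega l (r * H) y ->
  (0 < \sum_f (y \in box l H r (shift_row f)) <= 2 ^ n)%N.
Proof.
move=> /OmegaE[By yn].
pose c i j := covers r (y 0 (lift ord_max i) / l 0 i) j.
have E f : (y \in box l H r (shift_row f)) = (\prod_i c i (f i))%N :> nat.
  have <- := big_morph nat_of_bool (fun x y => esym (mulnb x y))
    (erefl (nat_of_bool true)).
  rewrite big_andE; congr nat_of_bool.
  apply/idP/forallP; rewrite inE.
    move=> /(boxE l H (shift_row f) r0)[yf _] i; have := yf i; rewrite mxE.
    by rewrite /c /covers ltr_pdivlMr// ltr_pdivrMr// mulrDl.
  move=> cf; apply/(boxE l H (shift_row f) r0); split=> // i; have := cf i.
  by rewrite mxE /c /covers ltr_pdivlMr// ltr_pdivrMr// mulrDl.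
under eq_bigr do rewrite E.
(* By distributivity, the number of boxes containing y is the product over the directions of the
   number of intervals containing y_i / l_i, each 1 or 2. *)
rewrite -(bigA_distr_bigA (fun i (j : 'I_(num_shifts r).+1) => c i j : nat)) /=.
have S i : (\sum_(j < (num_shifts r).+1) c i j)%N =
    #|[pred j : 'I_(num_shifts r).+1 | covers r (y 0 (lift ord_max i) / l 0 i) j]|.
  rewrite -sum1_card [RHS]big_mkcond; apply: eq_bigr => j _.
  by rewrite inE /c; case: covers.
under eq_bigr do rewrite S.
apply/andP; split.
  apply: prodn_gt0 => i; apply: card_covers_gt0 => //.
  have /andP[yi0 yil] := By i; rewrite mxE in yi0 yil.
  by rewrite divr_gt0//= ltr_pdivrMr// mul1r.
rewrite -[X in (_ <= _ ^ X)%N]card_ord -prod_nat_const.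
by apply: leq_prod => i _; exact: card_covers_le2.
Qed.

Lemma korn_scaled K : korn l H K -> korn l (r * H) (K * 2 ^+ n).
Proof.
move=> hK u G uB uG.
have mG i j : measurable_fun (Omega l (r * H)) (fun x => G x i j).
  have [_ /(_ j)[[+ _] _]] := uG i.
  by under eq_fun do rewrite mxE.
have mO := measurable_Omega l (r * H).
have mb f := measurable_box l H r (shift_row f).
have bO f := box_sub (H := H) r0 (shift_row_bound f).
have [GA _] := ge0_integral_covering (lebesgue_rV R n.+1) mO mb bO sum_box
  (measurable_frobenius2 mG) (fun x => sqr_ge0 (frobenius (G x))).
have mS : measurable_fun (Omega l (r * H)) (fun x => frobenius (sym_grad (G x)) ^+ 2).
  apply: measurable_frobenius2 => i j; under eq_fun do rewrite !mxE.
  by apply: measurable_funM => //; exact: measurable_funD.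
have [SB SC] := ge0_integral_covering (lebesgue_rV R n.+1) mO mb bO sum_box
  mS (fun x => sqr_ge0 (frobenius (sym_grad (G x)))).
set X := integral _ _ _ in GA *; set Y := integral _ _ _ in SB SC *.
set Z := (\sum_f _)%E in SB SC.
have XZ : (X <= K%:E * Z)%E.
  apply: le_trans GA _; rewrite /Z ge0_sume_distrr; last first.
    by move=> f _; apply: integral_ge0 => x _; rewrite lee_fin sqr_ge0.
  by apply: lee_sum => f _; apply: korn_box => //; exact: shift_row_bound.
have Y0 : (0 <= Y)%E by apply: integral_ge0 => x _; rewrite lee_fin sqr_ge0.
(* [korn] allows any real K, and the overlap bound on Z can be multiplied by K only when K is
   nonnegative. *)
have [K0|K0] := leP 0 K.
  apply: le_trans XZ _; rewrite EFinM -muleA -natrX.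
  by apply: lee_wpmul2l => //; rewrite lee_fin.
(* K < 0 forces all the integrals to vanish. *)
have X0 : (0 <= X)%E by apply: integral_ge0 => x _; rewrite lee_fin sqr_ge0.
have : (0 <= K%:E * Z)%E by exact: le_trans XZ.
rewrite nmule_rge0 ?lte_fin// => Z0.
have YE : Y = 0%E by apply/eqP; rewrite eq_le Y0 (le_trans SB Z0).
have ZE : Z = 0%E by apply/eqP; rewrite eq_le Z0 (le_trans Y0 SB).
by move: XZ; rewrite YE ZE !mule0.
Qed.

End boxes.
End covering.

Theorem theorem7 (R : realType) (n : nat) (hn : n.+1 = 2%N \/ n.+1 = 3%N)
    (l : 'rV[R]_n) (hl : forall i, 0 < l 0 i) (H : R) (hH : 0 < H)
    (K : R) (hK : korn l H K) (h : R) (hh : 0 < h <= H) :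
  korn l h (K * 2 ^+ n).
Proof.
have /andP[h0 hH'] := hh.
have H0 : H != 0 by rewrite gt_eqF.
(* The ratio is r = h / H, at most 1 since h <= H. *)
rewrite -(divfK H0 h); apply: korn_scaled => //; first exact: divr_gt0.
by rewrite ler_pdivrMr// mul1r.
Qed.
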